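(* Let $p\in(0,1)$, let $\mathcal{M}=(M_n)_{n\in\mathbb{Z}_+}$ be a deterministic sequence of non-negative ranges (not necessarily non-decreasing), and let $\bar{\mathcal{G}}$ be the oriented graph with ranges $\mathcal{M}$. Let the letters $(X_n)_{n\in\mathbb{Z}_+}$ be i.i.d. Bernoulli($p$), with law $P_{\bar{\mathcal{G}}}$. Put $$C=\frac{1}{\log\left(\frac{1}{\max\{p,1-p\}}\right)}.$$ Then: 1. If $\displaystyle\limsup_{n\to\infty}\frac{M_n}{\log(n)}<C$, then $P_{\bar{\mathcal{G}}}(W_0=\Xi)=0$. 2. If $\displaystyle\liminf_{n\to\infty}\frac{M_n}{\log(n)}>C$ and $M_n\geq2$ for all $n\in\mathbb{Z}_+$, then $P_{\bar{\mathcal{G}}}(W_0=\Xi)>0$.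
   Context: $\mathbb{Z}_+=\{0,1,2,\dots\}$, $\mathbb{N}=\{1,2,3,\dots\}$, and $\log$ is the natural logarithm. A word is a sequence $\xi=(\xi_1,\xi_2,\dots)\in\Xi:=\{0,1\}^{\mathbb{N}}$. Given a sequence of (finite, non-negative) ranges $\mathcal{M}=(M_n)_{n\in\mathbb{Z}_+}$, the graph $\bar{\mathcal{G}}=(\mathbb{Z}_+,\mathcal{E})$ is the oriented graph with edge set $\mathcal{E}=\bigcup_{n\in\mathbb{Z}_+}\{(n,n+i): i\in\mathbb{N},\ 0<i\leq M_n\}$. The letter $X_n\in\{0,1\}$ is assigned to vertex $n$, with $X_n=1$ with probability $p$. A word $\xi$ is seen from a vertex $v_0$ if there is a sequence of distinct vertices $v_1,v_2,\dots$ such that $(v_{i-1},v_i)\in\mathcal{E}$ and $X_{v_i}=\xi_i$ for every $i\geq1$ (the letter at $v_0$ plays no role). For a vertex $v$, $W_v=\{\xi\in\Xi:\xi\text{ is seen from }v\}$. *)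

(* Defs.v *)
From HB Require Import structures.
From mathcomp Require Import all_boot all_order all_algebra.
From mathcomp Require Import all_classical all_reals all_analysis.

Set Implicit Arguments.
Unset Strict Implicit.
Unset Printing Implicit Defensive.

Import Order.TTheory GRing.Theory Num.Theory.

Local Open Scope classical_set_scope.
Local Open Scope ring_scope.

(* Words are indexed from 0: [xi i] is the letter usually written xi_{i+1},
   and [true] is the letter 1. *)
Definition word := nat -> bool.

Section oriented_graph.
Context {R : realType}.

Definition edge (M : nat -> R) (m n : nat) : Prop :=
  exists i : nat, [/\ (0 < i)%N, i%:R <= M m & n = (m + i)%N].

End oriented_graph.

Section seen_words.
Context {V : Type}.

Definition seen_from (E : V -> V -> Prop) (x : V -> bool) (v0 : V) (xi : word)
    : Prop :=
  exists v : nat -> V,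
    [/\ v 0%N = v0,
        injective (fun i => v i.+1) &
        forall i, E (v i) (v i.+1) /\ x (v i.+1) = xi i].

Definition seen_words (E : V -> V -> Prop) (x : V -> bool) (v0 : V) : set word :=
  [set xi | seen_from E x v0 xi].

End seen_words.

Section iid.
Context {d d'} {T : measurableType d} {T' : measurableType d'} {R : realType}.

Definition mutually_independent (P : probability T R) (X : nat -> {RV P >-> T'})
    : Prop :=
  forall (s : seq nat) (A : nat -> set T'),
    uniq s -> (forall n, measurable (A n)) ->
    P (\bigcap_(n in [set` s]) X n @^-1` A n)
      = (\prod_(n <- s) P (X n @^-1` A n))%E.

End iid.

Definition iid_bernoulli {d : measure_display} {T : measurableType d}
    {R : realType} (P : probability T R) (p : R) (X : nat -> {RV P >-> bool})
    : Prop :=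
  mutually_independent X /\ forall n, P (X n @^-1` [set true]) = p%:E.

Definition critical_constant {R : realType} (p : R) : R :=
  1 / ln (1 / Num.max p (1 - p)).

(* Main.v *)
Require Import Defs.
From HB Require Import structures.
From mathcomp Require Import all_boot all_order all_algebra.
From mathcomp Require Import all_classical all_reals all_analysis.
From mathcomp Require Import zify ring lra.

Set Implicit Arguments.
Unset Strict Implicit.
Unset Printing Implicit Defensive.

Import Order.TTheory GRing.Theory Num.Theory.

Local Open Scope classical_set_scope.
Local Open Scope ring_scope.

(** Write q = max(p, 1-p) = e^(-l), so that the critical constant is 1/l.  A run
    of L likely letters starting at a given place has probability e^(-lL), and
    among the first n vertices there are about n/L disjoint places for one, so
    runs of length L become frequent once n passes e^(lL), that is, once
    L < (log n)/l.  The theorem compares the ranges with the length of these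
    longest runs.

    Subcritical ranges: if M_n <= c log n eventually with c < 1/l, then every
    vertex below e^(L/c) has range at most L, so no path jumps over a run of L
    likely letters lying there, and the word made of the unlikely letter only is
    not seen ([run_hides_constant_word]).  About e^(L/c)/L disjoint blocks
    are available, each is a run with probability e^(-lL), and the expected
    number of runs, e^((1/c-l)L)/L, is unbounded; by independence of the blocks
    ([probability_no_run]) the probability that none occurs tends to 0 as L
    grows ([avoid_run_bound]).

    Supercritical ranges: all words are seen as soon as every vertex sees both
    letters in its range ([all_seen_of_windows]).  On a finite initial segment
    this is forced by alternating letters, because the ranges are at least 2
    ([all_seen_of_alternating_start]), and alternation there has positive
    probability.  Beyond vertex N, a range fails with probability of order
    e^(-l c log n) = n^(-cl) where cl > 1, which has a small tail sum
    ([window_tail_small]); cutting each window down to the vertices outside the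
    initial segment makes the failures independent of the alternation, so with
    positive probability the alternation occurs and no failure does.

    Both parts need the event that all words are seen to be measurable, although
    it quantifies over uncountably many words.  As every vertex has finitely many
    successors, Konig's lemma reduces it to the countably many finite words
    ([seen_words_setT]). *)

(** * Paths in the oriented graph *)

Lemma edgeP (R : realType) (M : nat -> R) (m n : nat) : 0 <= M m ->
  edge M m n <-> n \in iota m.+1 (Num.truncn (M m)).
Proof.
move=> M0; rewrite mem_iota; split=> [[i [i0 iM ->]]|/andP[mn nM]].
  by have := iM; rewrite -truncn_ge_nat //; lia.
exists (n - m)%N; split; [lia| |lia].
by rewrite -truncn_ge_nat //; lia.
Qed.

Lemma path_ltn (R : realType) (M : nat -> R) (v : nat -> nat) :
  (forall i, edge M (v i) (v i.+1)) -> {homo v : i j / (i < j)%N}.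
Proof.
move=> vP; apply: homo_ltn => [? ? ?|k]; first exact: ltn_trans.
by have [i [i0 _ ->]] := vP k; lia.
Qed.

Lemma path_inj (R : realType) (M : nat -> R) (v : nat -> nat) :
  (forall i, edge M (v i) (v i.+1)) -> injective (fun i => v i.+1).
Proof.
move=> /path_ltn vlt i j /= vij; case: (ltngtP i j) => // ij.
  by have := vlt i.+1 j.+1 ij; rewrite vij ltnn.
by have := vlt j.+1 i.+1 ij; rewrite vij ltnn.
Qed.

(** Visibility of a finite word, computed by recursion on the word rather than
    stated by the existence of a path, so that its measurability follows by
    induction. *)
Fixpoint sees (R : realType) (M : nat -> R) (x : nat -> bool) (u : seq bool)
    (v : nat) : bool :=
  if u is b :: u' then
    has (fun n => (x n == b) && sees M x u' n) (iota v.+1 (Num.truncn (M v)))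
  else true.

Lemma sees_path (R : realType) (M : nat -> R) (x : nat -> bool) (xi : word)
    (v : nat -> nat) (n k : nat) : (forall i, 0 <= M i) ->
  (forall i, edge M (v i) (v i.+1) /\ x (v i.+1) = xi i) ->
  sees M x (map xi (iota k n)) (v k).
Proof.
move=> M0 vP; elim: n k => //= n IH k; apply/hasP; exists (v k.+1).
  by apply/edgeP => //; case: (vP k).
by rewrite (vP k).2 eqxx IH.
Qed.

Lemma sees_le (R : realType) (M : nat -> R) (x : nat -> bool) (xi : word)
    (m n k v : nat) : (m <= n)%N ->
  sees M x (map xi (iota k n)) v -> sees M x (map xi (iota k m)) v.
Proof.
elim: m n k v => //= m IH [//|n] k v mn /= /hasP[w ws /andP[xw sw]].
by apply/hasP; exists w => //; rewrite xw (IH n).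
Qed.

(** The step of Konig's lemma: if every prefix can be continued from [v], then one
    of the finitely many successors of [v] serves infinitely many prefixes, hence
    all of them because visibility passes to shorter prefixes. *)
Lemma sees_all_step (R : realType) (M : nat -> R) (x : nat -> bool) (xi : word)
    (k v : nat) :
  (forall n, sees M x (map xi (iota k n)) v) ->
  exists v', [/\ v' \in iota v.+1 (Num.truncn (M v)), x v' = xi k &
    forall n, sees M x (map xi (iota k.+1 n)) v'].
Proof.
move=> sv; apply: contrapT => /forallNP nv.
have /choice[N NP] : forall v', exists n, v' \in iota v.+1 (Num.truncn (M v)) ->
    ~~ ((x v' == xi k) && sees M x (map xi (iota k.+1 n)) v').
  move=> v'; apply: contrapT => /forallNP nn; apply: (nv v'); split.
  - by apply: contrapT => v'P; apply: (nn 0%N).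
  - by apply: contrapT => v'P; apply: (nn 0%N) => _; apply/negP => /andP[/eqP].
  - move=> n; apply: contrapT => v'P; apply: (nn n) => _.
    by apply/negP => /andP[_]; exact: v'P.
(* If each successor v' fails at some length N v', then all of them fail at the
   largest of these lengths. *)
have /= /hasP[v' v'M /andP[xv' sv']] :=
  sv (\max_(w <- iota v.+1 (Num.truncn (M v))) N w).+1.
have /negP := NP v' v'M; apply; rewrite xv' /=.
by apply: sees_le sv'; exact: leq_bigmax_seq.
Qed.

(** Compactness: a word all of whose prefixes are seen is itself seen, by
    iterating [sees_all_step] and choosing one surviving successor at a time. *)
Lemma seen_words_setT (R : realType) (M : nat -> R) (x : nat -> bool)
    (v0 : nat) : (forall i, 0 <= M i) ->
  seen_words (edge M) x v0 = setT <-> forall u, sees M x u v0.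
Proof.
move=> M0; split=> [allseen u|su].
  have : seen_words (edge M) x v0 (nth false u) by rewrite allseen.
  case=> v [v0E _ vP]; have := sees_path (size u) 0 M0 vP.
  by rewrite v0E map_nth_iota0 // take_size.
apply/seteqP; split=> // xi _.
have /choice[f fP] : forall s : nat * nat, exists v',
    (forall n, sees M x (map xi (iota s.1 n)) s.2) ->
    [/\ v' \in iota s.2.+1 (Num.truncn (M s.2)), x v' = xi s.1 &
        forall n, sees M x (map xi (iota s.1.+1 n)) v'].
  move=> [k v] /=.
  have [/sees_all_step[v' v'P]|h] :=
    pselect (forall n, sees M x (map xi (iota k n)) v); first by exists v'.
  by exists 0%N => /h.
pose v := fix v k := if k is k'.+1 then f (k', v k') else v0.
have vS k n : sees M x (map xi (iota k n)) (v k).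
  by elim: k n => [n|k IH] /=; [exact: su|case: (fP (k, v k) IH)].
have vP k := fP (k, v k) (vS k).
have ve k : edge M (v k) (v k.+1) by have [? _ _] := vP k; apply/edgeP.
by exists v; split=> //; [exact: path_inj ve|move=> k; have [_ ? _] := vP k].
Qed.

Lemma path_crosses_window (v : nat -> nat) (m : nat) :
  {homo v : i j / (i < j)%N} -> (v 0 < m)%N ->
  exists i, (v i < m <= v i.+1)%N.
Proof.
move=> vlt v0m.
have vge k : (k <= v k)%N.
  elim: k => // k IH; apply: leq_ltn_trans IH _; exact: vlt.
have ex : exists i, (m <= v i)%N by exists m.
case: (ex_minnP ex) => -[|i] mi imin; first by lia.
by exists i; rewrite mi andbT ltnNge; apply/negP => /imin; rewrite ltnn.
Qed.

(** A path reading the constant word [b] has to pass vertex [m]; the step that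
    does so starts at a vertex of range at most [L], hence lands inside the run
    of length [L] and reads the wrong letter. *)
Lemma run_hides_constant_word (R : realType) (M : nat -> R) (x : nat -> bool) (b : bool)
    (m L : nat) : (0 < m)%N ->
  (forall k, (k < m)%N -> M k <= L%:R) ->
  (forall i, (m <= i < m + L)%N -> x i = ~~ b) ->
  seen_words (edge M) x 0 <> setT.
Proof.
move=> m0 ML xrun allseen.
have : seen_words (edge M) x 0%N (fun=> b) by rewrite allseen.
case=> v [v0 _ vP].
have vlt := path_ltn (fun i => (vP i).1).
have [|i /andP[vim mvi]] := path_crosses_window (m := m) vlt; first by rewrite v0.
have [[j [j0 jM vE]] xb] := vP i.
have jL : (j <= L)%N by rewrite -(ler_nat R); apply: le_trans jM (ML _ vim).
have : x (v i.+1) = ~~ b by apply: xrun; lia.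
by rewrite xb; case: (b).
Qed.

Lemma all_seen_of_windows (R : realType) (M : nat -> R) (x : nat -> bool)
    (v0 : nat) : 
  (forall n b, exists2 i, edge M n i & x i = b) ->
  seen_words (edge M) x v0 = setT.
Proof.
move=> next; apply/seteqP; split=> // xi _.
have /choice[f fP] : forall s : nat * bool, exists i,
    edge M s.1 i /\ x i = s.2.
  by move=> [n b]; have [i] := next n b; exists i.
pose v := fix v k := if k is k'.+1 then f (v k', xi k') else v0.
have vP k : edge M (v k) (v k.+1) /\ x (v k.+1) = xi k := fP (v k, xi k).
by exists v; split=> //; exact: path_inj (fun i => (vP i).1).
Qed.

(** The vertices below [N] use the alternation on their next two neighbours. The
    alternation reaches up to [N + 1], so that for [n >= N] the window starting
    at [n + 2] is disjoint from the alternating segment. *)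
Lemma all_seen_of_alternating_start (R : realType) (M : nat -> R)
    (x : nat -> bool) (N : nat) :
  (forall n, 2 <= M n) -> {in iota 0 (N + 2), forall i, x i = odd i} ->
  (forall n b, (N <= n)%N ->
    ~ {in iota (n + 2) (Num.truncn (M n)).-1, forall i, x i = b}) ->
  seen_words (edge M) x 0 = setT.
Proof.
move=> M2 xstart good; apply: all_seen_of_windows => n b.
have M0 : 0 <= M n by exact: le_trans (M2 n).
have t2 : (2 <= Num.truncn (M n))%N by rewrite truncn_ge_nat.
have [nN|Nn] := ltnP n N.
  pose i := if odd n.+1 == b then n.+1 else n.+2.
  exists i.
    by apply/(edgeP _ M0); rewrite mem_iota /i; case: ifP => _; lia.
  rewrite xstart ?mem_iota /i; last by case: ifP; lia.
  by case: ifP => [/eqP //|]; rewrite /= negbK; case: odd; case: (b).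
apply: contrapT => nob; apply: (good n (~~ b) Nn) => i.
rewrite mem_iota => iI; apply: contrapT => xi; apply: nob.
exists i; last by move: xi; case: (x i); case: (b).
by apply/(edgeP _ M0); rewrite mem_iota; lia.
Qed.

(** * Cylinder events *)

Lemma measurable_letter d (T : measurableType d) (R : realType)
    (P : probability T R) (X : nat -> {RV P >-> bool}) (n : nat) (b : bool) :
  measurable [set w | X n w = b].
Proof. exact: (measurable_funPTI (X n) (Y := [set b])). Qed.

Lemma measurable_has d (T : measurableType d) (I : Type) (a : T -> pred I)
    (s : seq I) :
  (forall i, measurable [set w | a w i]) -> measurable [set w | has (a w) s].
Proof.
move=> am; elim: s => [|i s IH] /=.
  by rewrite (_ : [set w | _] = set0) ?measurable0 //; apply/seteqP; split.
rewrite (_ : [set w | _] = [set w | a w i] `|` [set w | has (a w) s]).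
  exact: measurableU.
by apply/seteqP; split=> w /orP.
Qed.

Lemma measurable_sees d (T : measurableType d) (R : realType)
    (P : probability T R) (X : nat -> {RV P >-> bool}) (M : nat -> R)
    (u : seq bool) (v : nat) :
  measurable [set w | sees M (fun n => X n w) u v].
Proof.
elim: u v => [|b u IH] v /=.
  by rewrite (_ : [set w | _] = setT) ?measurableT //; apply/seteqP; split.
apply: (measurable_has (a := fun w n => (X n w == b) && _)) => n.
rewrite (_ : [set w | _] = [set w | X n w = b] `&`
                           [set w | sees M (fun n => X n w) u n]).
  by apply: measurableI => //; exact: measurable_letter.
by apply/seteqP; split=> w /= => [/andP[/eqP]|[/eqP -> ->]].
Qed.

(** Compactness replaces the uncountable intersection over infinite words by a
    countable one over finite words, enumerated by [unpickle]. *)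
Lemma measurable_seen_words_setT d (T : measurableType d) (R : realType)
    (P : probability T R) (X : nat -> {RV P >-> bool}) (M : nat -> R)
    (v : nat) : (forall n, 0 <= M n) ->
  measurable [set w | seen_words (edge M) (fun n => X n w) v = setT].
Proof.
move=> M0.
rewrite (_ : [set w | _] = \bigcap_k
    [set w | if unpickle k is Some u then sees M (fun n => X n w) u v
             else true]).
  apply: bigcapT_measurable => k; case: unpickle => [u|].
    exact: measurable_sees.
  by rewrite (_ : [set w | _] = setT) ?measurableT //; apply/seteqP; split.
apply/seteqP; split=> w.
  by rewrite /mkset => /(seen_words_setT _ _ M0) su k _; case: unpickle.
move=> su; apply/(seen_words_setT _ _ M0) => u.
by have := su (pickle u) I; rewrite /mkset pickleK.
Qed.

Lemma measurable_cylinder d (T : measurableType d) (R : realType)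
    (P : probability T R) (X : nat -> {RV P >-> bool}) (s : seq nat)
    (f : nat -> bool) :
  measurable [set w | {in s, forall n, X n w = f n}].
Proof.
rewrite (_ : [set w | _] = ~` [set w | has (fun n => X n w != f n) s]).
  apply/measurableC/(measurable_has (a := fun w n => X n w != f n)) => n.
  rewrite (_ : [set w | _] = ~` [set w | X n w = f n]).
    exact/measurableC/measurable_letter.
  by apply/seteqP; split=> w /= /eqP.
apply/seteqP; split=> w /=.
  by move=> h /hasP[n ns /eqP]; apply; exact: h.
by move=> /negP/hasPn h n /h /negPn/eqP.
Qed.

Lemma probability_cylinder d (T : measurableType d) (R : realType)
    (P : probability T R) (p : R) (X : nat -> {RV P >-> bool}) (s : seq nat)
    (f : nat -> bool) : iid_bernoulli p X -> uniq s ->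
  P [set w | {in s, forall n, X n w = f n}] =
  (\prod_(n <- s) bernoulli_pmf p (f n))%:E.
Proof.
move=> [indep Xp] us.
have -> : [set w | {in s, forall n, X n w = f n}] =
    \bigcap_(n in [set` s]) X n @^-1` [set f n].
  by apply/seteqP; split.
rewrite (indep s (fun n => [set f n])) // -prodEFin; apply: eq_bigr => n _.
case: (f n) => //=.
rewrite (_ : X n @^-1` [set false] = ~` (X n @^-1` [set true])).
  by rewrite probability_setC ?Xp ?EFinB //; exact: measurable_letter.
by apply/seteqP; split=> w /=; case: (X n w).
Qed.

Lemma probability_cylinderI d (T : measurableType d) (R : realType)
    (P : probability T R) (p : R) (X : nat -> {RV P >-> bool}) (s t : seq nat)
    (f g : nat -> bool) : iid_bernoulli p X -> uniq (s ++ t) ->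
  P ([set w | {in s, forall n, X n w = f n}] `&`
     [set w | {in t, forall n, X n w = g n}]) =
  (P [set w | {in s, forall n, X n w = f n}] *
   P [set w | {in t, forall n, X n w = g n}])%E.
Proof.
move=> Xp ust; pose h n := if n \in s then f n else g n.
have [us disj ut] := and3P (etrans (esym (cat_uniq s t)) ust).
have ht n : n \in t -> h n = g n.
  by move=> nt; rewrite /h ifN //; exact: (hasPn disj).
have -> : [set w | {in s, forall n, X n w = f n}] `&`
    [set w | {in t, forall n, X n w = g n}] =
    [set w | {in s ++ t, forall n, X n w = h n}].
  apply/seteqP; split=> w => [[ws wt] n|hw].
    rewrite mem_cat => /orP[ns|nt]; first by rewrite ws // /h ns.
    by rewrite wt // ht.
  split=> n nI; rewrite hw ?mem_cat ?nI ?orbT //; last exact: ht.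
  by rewrite /h nI.
rewrite (probability_cylinder f Xp us) (probability_cylinder g Xp ut).
rewrite (probability_cylinder h Xp ust) big_cat -EFinM.
congr (_ * _)%:E; apply: eq_big_seq => n nI; first by rewrite /h nI.
by rewrite ht.
Qed.

Lemma probability_constant_run d (T : measurableType d) (R : realType)
    (P : probability T R) (p : R) (X : nat -> {RV P >-> bool}) (s : seq nat)
    (b : bool) : iid_bernoulli p X -> uniq s ->
  P [set w | {in s, forall n, X n w = b}] = (bernoulli_pmf p b ^+ size s)%:E.
Proof.
move=> Xp us; rewrite (probability_cylinder (fun=> b) Xp us).
by rewrite big_const_seq count_predT iter_mulr_1.
Qed.

(** Independence of disjoint blocks, proved from cylinder probabilities only.
    The event on [s] strengthens the induction: removing the last block [B] splits
    the probability into one term without [B] and one where [B] is a run and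
    joins [s], and
    [q^|s| (1-q^L)^k - q^(|s|+L) (1-q^L)^k = q^|s| (1-q^L)^(k+1)].
    Block [j] starts at [1 + j * L], since the letter of vertex 0 is never
    read. *)
Lemma probability_no_run d (T : measurableType d) (R : realType)
    (P : probability T R) (p : R) (X : nat -> {RV P >-> bool}) (b : bool)
    (L k : nat) (s : seq nat) : iid_bernoulli p X -> uniq s ->
  (forall i, i \in s -> (1 + k * L <= i)%N) ->
  let no_run := [set w | forall j, (j < k)%N ->
    ~ {in iota (1 + j * L) L, forall n, X n w = b}] in
  measurable no_run /\
  P ([set w | {in s, forall n, X n w = b}] `&` no_run) =
    (bernoulli_pmf p b ^+ size s * (1 - bernoulli_pmf p b ^+ L) ^+ k)%:E.
Proof.
move=> Xp; elim: k s => [|k IH] s us sk.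
  rewrite /= (_ : [set w | forall j, _] = setT); last first.
    by apply/seteqP; split=> // w _ j; rewrite ltn0.
  split; first exact: measurableT.
  by rewrite setIT (probability_constant_run _ Xp) // expr0 mulr1.
move=> no_run.
pose run (t : seq nat) := [set w | {in t, forall n, X n w = b}].
pose blk := iota (1 + k * L) L.
pose prev := [set w | forall j, (j < k)%N ->
    ~ {in iota (1 + j * L) L, forall n, X n w = b}].
have runm t : measurable (run t) := measurable_cylinder X t (fun=> b).
have no_runE : no_run = prev `\` run blk.
  apply/seteqP; split=> w /= => [h|[h1 h2] j].
    by split=> [j jk|]; apply: h; lia.
  by rewrite ltnS leq_eqVlt => /predU1P[-> //|]; exact: h1.
have [prevm _] := IH [::] isT (fun _ => ltac:(done)).
have sblk : uniq (s ++ blk).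
  rewrite cat_uniq us iota_uniq andbT /=; apply/hasPn => i /=.
  by rewrite mem_iota; apply: contraTN => /sk; lia.
have [_ P1] := IH s us (fun i si => ltac:(have := sk i si; lia)).
have blkk i : i \in s ++ blk -> (1 + k * L <= i)%N.
  by rewrite mem_cat mem_iota => /orP[/sk|]; lia.
have [_ P2] := IH _ sblk blkk.
split; first by rewrite no_runE; exact: measurableD.
have runC : run (s ++ blk) = run s `&` run blk.
  apply/seteqP; split=> w /= => [h|[h1 h2] i].
    by split=> i si; apply: h; rewrite mem_cat si ?orbT.
  by rewrite mem_cat => /orP[/h1|/h2].
have spm : measurable (run s `&` prev) by exact: measurableI.
have PD : P (run s `&` no_run) =
    (P (run s `&` prev) - P (run (s ++ blk) `&` prev))%E.
  rewrite no_runE setIDA measureD //; last first.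
    by rewrite (le_lt_trans (probability_le1 _ _)) ?ltry.
  by rewrite runC setIAC.
rewrite PD P1 P2 size_cat size_iota -EFinB; congr EFin.
by rewrite exprD exprSr; ring.
Qed.

(** * Real estimates *)

(** A limsup below [l] leaves room for a constant strictly between them that
    bounds a whole tail; that strict gap is what drives all the estimates. *)
Lemma limn_esup_lt_eventually (R : realType) (f : nat -> R) (l : R) :
  (limn_esup (fun n => (f n)%:E) < l%:E)%E ->
  exists2 c, c < l & exists N, forall n, (N <= n)%N -> f n <= c.
Proof.
move=> /ereal_inf_lt[_ [V [N _ NV] <-]] supl.
have fsup n : (N <= n)%N -> ((f n)%:E <= ereal_sup [set (f x)%:E | x in V])%E.
  by move=> Nn; apply: ereal_sup_ubound; exists n => //; exact: NV.
have sup_fin : ereal_sup [set (f x)%:E | x in V] \is a fin_num.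
  by rewrite fin_numElt (lt_le_trans (ltNyr _) (fsup N _)) // (lt_trans supl) ?ltry.
exists (fine (ereal_sup [set (f x)%:E | x in V])).
  by rewrite -lte_fin fineK.
by exists N => n /fsup; rewrite -lee_fin fineK.
Qed.

Lemma limn_einf_gt_eventually (R : realType) (f : nat -> R) (l : R) :
  (l%:E < limn_einf (fun n => (f n)%:E))%E ->
  exists2 c, l < c & exists N, forall n, (N <= n)%N -> c <= f n.
Proof.
rewrite /limn_einf lteNr => /(limn_esup_lt_eventually (f := fun n => - f n)).
move=> [c cl [N cN]]; exists (- c); first by rewrite ltrNr.
by exists N => n /cN; rewrite lerNl.
Qed.

Lemma maxr_compl_itv (R : realType) (p : R) : 0 < p -> p < 1 ->
  0 < Num.max p (1 - p) < 1.
Proof. by move=> p0 p1; rewrite lt_max p0 gt_max p1 /=; lra. Qed.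

(** The parametrisation used below: [l] is the exponential rate at which long runs
    of the likely letter become rare. *)
Lemma critical_constant_inv (R : realType) (p : R) : 0 < p -> p < 1 ->
  exists2 l, 0 < l & critical_constant p = l^-1 /\ Num.max p (1 - p) = expR (- l).
Proof.
move=> p0 p1; have /andP[q0 q1] := maxr_compl_itv p0 p1.
exists (- ln (Num.max p (1 - p))); first by rewrite oppr_gt0 ln_lt0 ?q0.
by rewrite /critical_constant !div1r lnV ?posrE // opprK lnK ?posrE.
Qed.

(** With [x = e^(-lL)] and [K] the integer part of [e^(L/c)/L], the left side is at
    most [e^(-Kx)], and [Kx] exceeds [e^((1/c-l)L)/L - 1].  The exponential beats
    [L^2], which gives a bound that vanishes as [L] grows. *)
Lemma avoid_run_bound (R : realType) (l c : R) (L : nat) :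
  0 < l -> 0 < c -> c < l^-1 -> (0 < L)%N ->
  exists2 K : nat, (K * L)%:R <= expR (L%:R / c) &
    (1 - expR (- l) ^+ L) ^+ K <= 2 / ((c^-1 - l) ^+ 2 * L%:R).
Proof.
move=> l0 c0 cl L0; set e := c^-1 - l.
have e0 : 0 < e by rewrite subr_gt0 -[l]invrK ltf_pV2 ?posrE ?invr_gt0.
have LR : 0 < L%:R :> R by rewrite ltr0n.
set y := expR (L%:R / c) / L%:R.
have y0 : 0 <= y by rewrite divr_ge0 ?expR_ge0.
have /andP[Ky yK] := truncn_itv y0; set K := Num.truncn y in Ky yK *.
exists K; first by rewrite natrM -ler_pdivlMr.
set x := expR (- l) ^+ L.
have xE : x = expR (- (l * L%:R)) by rewrite /x -expRM_natr mulNr.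
have x0 : 0 < x by rewrite xE expR_gt0.
have x1 : x <= 1 by rewrite xE -[leRHS]expR0 ler_expR oppr_le0 mulr_ge0 // ltW.
apply: (@le_trans _ _ (expR (- (K%:R * x)))).
  rewrite -mulrN expRM_natl lerXn2r ?nnegrE ?subr_ge0 ?expR_ge0 //.
  exact: expR_ge1Dx.
have big : e ^+ 2 * L%:R / 2 <= expR (K%:R * x).
  apply: le_trans (expR_ge1Dx _).
  have xy : x * y = expR (e * L%:R) / L%:R.
    rewrite /y mulrA xE -expRD; congr (expR _ / _).
    by rewrite /e; field; rewrite gt_eqF.
  have : (e * L%:R) ^+ 2 / 2 <= expR (e * L%:R).
    apply: le_trans (expR_ge1Dxn 1 _); last by rewrite mulr_ge0 // ltW.
    by rewrite lerDr.
  rewrite -(ler_pM2r (x := L%:R^-1)) ?invr_gt0 // -xy.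
  have -> : (e * L%:R) ^+ 2 / 2 / L%:R = e ^+ 2 * L%:R / 2.
    by field; rewrite gt_eqF.
  move=> /le_trans; apply.
  move: yK; rewrite -natr1 => /ltW yK.
  apply: le_trans (_ : x * (K%:R + 1) <= _); first by rewrite ler_pM2l.
  by rewrite mulrDr mulr1 addrC [x * _]mulrC lerD2r.
rewrite expRN -[leRHS]invrK lef_pV2 ?posrE ?expR_gt0 ?invf_div //.
by rewrite divr_gt0 // mulr_gt0 ?exprn_gt0.
Qed.

(** The sum of [k^(-1-s)] is compared with the telescoping sum of [k^(-s)]:
    [exp x >= 1 + x] and [log k <= log (k+1) - 1/(k+1)] give
    [k^(-s) >= (k+1)^(-s) (1 + s/(k+1))]. *)
Lemma power_tail_step (R : realType) (s : R) (k : nat) : 0 < s -> (0 < k)%N ->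
  expR (- ((1 + s) * ln k.+1%:R)) <=
  (expR (- (s * ln k%:R)) - expR (- (s * ln k.+1%:R))) / s.
Proof.
move=> s0 k0; set t : R := k.+1%:R.
have t0 : 0 < t by rewrite ltr0n.
have lnk : ln k%:R <= ln t - t^-1.
  have kR : 0 < k%:R :> R by rewrite ltr0n.
  have kE : k%:R = t * (1 - t^-1).
    by rewrite mulrBr mulr1 mulfV ?gt_eqF // /t -natr1 addrK.
  have u0 : 0 < 1 - t^-1 by rewrite -(pmulr_rgt0 _ t0) -kE.
  rewrite kE lnM ?posrE // lerD2l; apply: le_ln1Dx.
  by rewrite -subr_gt0 opprK addrC.
rewrite ler_pdivlMr // lerBrDr.
have -> : expR (- ((1 + s) * ln t)) = expR (- (s * ln t)) * t^-1.
  have tV : t^-1 = expR (- ln t) by rewrite expRN lnK ?posrE.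
  by rewrite tV -expRD; congr expR; ring.
apply: le_trans (_ : expR (- (s * ln t) + s * t^-1) <= _).
  rewrite expRD -mulrA -[X in _ + X]mulr1 -mulrDr ler_pM2l ?expR_gt0 //.
  by rewrite addrC mulrC expR_ge1Dx.
by rewrite ler_expR -mulrN -mulrDr -mulrN ler_pM2l // lerNr opprD opprK.
Qed.

Lemma power_tail_sum (R : realType) (s : R) (N n : nat) : 0 < s -> (0 < N)%N ->
  \sum_(N.+1 <= k < n) expR (- ((1 + s) * ln k%:R)) <= expR (- (s * ln N%:R)) / s.
Proof.
move=> s0 N0; have [nN|/ltnW Nn] := leqP n N.+1.
  by rewrite big_geq // divr_ge0 ?expR_ge0 // ltW.
have telescope : \sum_(N.+1 <= k < n) expR (- ((1 + s) * ln k%:R)) <=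
    (expR (- (s * ln N%:R)) - expR (- (s * ln n.-1%:R))) / s.
  rewrite -[n in leLHS](prednK (n := n)); last by lia.
  have {Nn} : (N <= n.-1)%N by lia.
  elim: n.-1 => [|m IH]; first by lia.
  rewrite leq_eqVlt => /predU1P[<-|].
    by rewrite big_geq // subrr mul0r.
  rewrite ltnS => Nm; rewrite big_nat_recr //=.
  apply: le_trans (lerD (IH Nm) (power_tail_step s0 _)) _; first by lia.
  by rewrite -mulrDl addrA subrK.
apply: le_trans telescope _.
by rewrite ler_pM2r ?invr_gt0 // gerBl expR_ge0.
Qed.

Lemma power_small (R : realType) (s e : R) (N0 : nat) : 0 < s -> 0 < e ->
  exists2 N, (N0 < N)%N & expR (- (s * ln N%:R)) < e.
Proof.
move=> s0 e0; set y := expR (- ln e / s).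
exists (maxn N0 (Num.truncn y)).+1; first by rewrite ltnS leq_maxl.
rewrite -[ltRHS]lnK ?posrE // ltr_expR ltrNl mulrC -ltr_pdivrMr //.
rewrite -ltr_expR lnK ?posrE ?ltr0n //.
by apply: lt_le_trans (truncnS_gt _) _; rewrite ler_nat ltnS leq_maxr.
Qed.

(** The exponent is at least [M k - 2 >= c log k - 2], so the [k]-th term is at
    most [e^(2l) k^(-cl)], the general term of a convergent series as [cl > 1]. *)
Lemma window_tail_small (R : realType) (M : nat -> R) (l c : R) (N0 : nat) :
  0 < l -> 1 < c * l -> (forall n, 2 <= M n) ->
  (forall n, (N0 <= n)%N -> c <= M n / ln n%:R) ->
  forall e, 0 < e -> exists N, forall n,
    \sum_(N <= k < n) expR (- l) ^+ (Num.truncn (M k)).-1 <= e.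
Proof.
move=> l0 cl M2 Mc e e0; pose s := c * l - 1.
have s0 : 0 < s by rewrite subr_gt0.
have D0 : 0 < expR (2 * l) by exact: expR_gt0.
have [N N0N small] := power_small (N0 + 2) s0 (divr_gt0 (mulr_gt0 s0 e0) D0).
have term k : (N < k)%N -> expR (- l) ^+ (Num.truncn (M k)).-1 <=
    expR (2 * l) * expR (- ((1 + s) * ln k%:R)).
  move=> Nk; have k1 : 1 < k%:R :> R by rewrite (ltr_nat _ 1); lia.
  have := Mc k (ltac:(lia)); rewrite ler_pdivlMr ?ln_gt0 // => cM.
  have tM : (0 < Num.truncn (M k))%N.
    by rewrite truncn_gt0; apply: le_trans (M2 k); rewrite ler1n.
  have len_ge : c * ln k%:R - 2 <= (Num.truncn (M k)).-1%:R.
    have := truncnS_gt (M k); rewrite -(prednK tM) -!natr1 => MS.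
    by rewrite lerBlDr; apply: le_trans cM _; apply: le_trans (ltW MS) _; lra.
  rewrite -expRM_natr -expRD ler_expR mulNr lerNl.
  apply: le_trans (_ : l * (c * ln k%:R - 2) <= _); last by rewrite ler_pM2l.
  by rewrite le_eqVlt; apply/orP; left; apply/eqP; rewrite /s; ring.
exists N.+1 => n.
apply: (@le_trans _ _ (expR (2 * l) * (expR (- (s * ln N%:R)) / s))).
  apply: (@le_trans _ _ (expR (2 * l) *
      \sum_(N.+1 <= k < n) expR (- ((1 + s) * ln k%:R)))).
    by rewrite mulr_sumr; apply: ler_sum_nat => k /andP[/term].
  by rewrite ler_pM2l // power_tail_sum //; lia.
rewrite mulrA ler_pdivrMr // mulrC -ler_pdivlMr //.
by rewrite [e * s]mulrC ltW.
Qed.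

(** * The two regimes *)

Lemma bernoulli_pmf_max (R : realType) (p : R) :
  exists b, bernoulli_pmf p b = Num.max p (1 - p).
Proof. by case: (leP p (1 - p)) => _; [exists false|exists true]. Qed.

Lemma bernoulli_pmf_le_max (R : realType) (p : R) (b : bool) :
  bernoulli_pmf p b <= Num.max p (1 - p).
Proof. by case: b; rewrite /= le_max lexx ?orbT. Qed.

Lemma bernoulli_pmf_gt0 (R : realType) (p : R) (b : bool) :
  0 < p -> p < 1 -> 0 < bernoulli_pmf p b.
Proof. by case: b => //= _; rewrite subr_gt0. Qed.

(** For [n] past the threshold, [M n <= c log n <= L]; the finitely many other
    ranges are bounded by their sum. *)
Lemma ranges_le_window (R : realType) (M : nat -> R) (c : R) (N : nat) :
  (forall n, 0 <= M n) -> 0 < c ->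
  (forall n, (N <= n)%N -> M n / ln n%:R <= c) ->
  exists L0, forall L n, (L0 <= L)%N -> n%:R <= expR (L%:R / c) -> M n <= L%:R.
Proof.
move=> M0 c0 Mc; exists (Num.truncn (\sum_(i < N + 2) M i)).+1 => L n LL nL.
have [nN|Nn] := ltnP n (N + 2).
  apply: le_trans (_ : \sum_(i < N + 2) M i <= _).
    by rewrite (bigD1 (Ordinal nN)) //= lerDl sumr_ge0.
  by apply: le_trans (ltW (truncnS_gt _)) _; rewrite ler_nat.
have n1 : 1 < n%:R :> R by rewrite (ltr_nat _ 1); lia.
have lnn0 : 0 < ln n%:R :> R by rewrite ln_gt0.
have := Mc n (ltac:(lia)); rewrite ler_pdivrMr // => /le_trans; apply.
rewrite mulrC -ler_pdivlMr // -ler_expR lnK // posrE.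
exact: lt_trans n1.
Qed.

(** Seeing all words excludes a run of the likely letter in each of the blocks
    allowed by [ranges_le_window], whatever the (large) block length [L]; letting
    [L] grow in [avoid_run_bound] leaves probability 0. *)
Lemma subcritical_not_all_seen d (T : measurableType d) (R : realType)
    (P : probability T R) (p : R) (M : nat -> R) (X : nat -> {RV P >-> bool}) :
  0 < p -> p < 1 -> (forall n, 0 <= M n) -> iid_bernoulli p X ->
  (limn_esup (fun n => (M n / ln n%:R)%:E) < (critical_constant p)%:E)%E ->
  P [set w | seen_words (edge M) (fun n => X n w) 0%N = setT] = 0%E.
Proof.
move=> p0 p1 M0 Xp /limn_esup_lt_eventually[c' c'C [N c'N]].
have [l l0 [CE qE]] := critical_constant_inv p0 p1.
(* c' may be 0; enlarging it to a positive constant below the critical value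
   makes e^(L/c) meaningful. *)
pose c := Num.max c' (l^-1 / 2).
have li0 : 0 < l^-1 by rewrite invr_gt0.
have c0 : 0 < c by rewrite lt_max divr_gt0 ?orbT.
have cl : c < l^-1 by rewrite gt_max -CE c'C CE; lra.
have cN n : (N <= n)%N -> M n / ln n%:R <= c.
  by move=> /c'N /le_trans; apply; rewrite le_max lexx.
have [L0 L0P] := ranges_le_window M0 c0 cN.
have [b bE] := bernoulli_pmf_max p.
set E := [set w | _].
have mE : measurable E by exact: measurable_seen_words_setT.
set e := c^-1 - l.
have e0 : 0 < e by rewrite subr_gt0 -[l]invrK ltf_pV2 ?posrE ?invr_gt0.
have PE L : (L0 <= L)%N -> (0 < L)%N ->
    (P E <= (2 / (e ^+ 2 * L%:R))%:E)%E.
  move=> LL Lgt0; have [K KL] := avoid_run_bound l0 c0 cl Lgt0.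
  rewrite -/e -qE -bE => Kbound.
  have [mno PnoE] := @probability_no_run _ _ _ _ _ _ b L K [::] Xp isT
    (fun _ => ltac:(done)).
  apply: (@le_trans _ _ ((1 - bernoulli_pmf p b ^+ L) ^+ K)%:E); last first.
    by rewrite lee_fin.
  move: PnoE; rewrite expr0 mul1r => <-.
  apply: le_measure; rewrite ?inE //.
    by apply: measurableI mno; exact: measurable_cylinder.
  move=> w Ew; split=> // j jK run.
  apply: (run_hides_constant_word (b := ~~ b) (m := 1 + j * L) (L := L)
    _ _ _ Ew) => // [n nj|i ij]; last first.
    by rewrite negbK; apply: run; rewrite mem_iota.
  apply: L0P => //; apply: le_trans KL; rewrite ler_nat.
  apply: (@leq_trans (j * L)); first by move: nj; rewrite add1n ltnS.
  by rewrite leq_mul2r ltnW ?orbT.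
apply/eqP; rewrite eq_le measure_ge0 andbT.
apply/lee_addgt0Pr => eps eps0; rewrite add0e.
pose L := (maxn L0 (Num.truncn (2 / (e ^+ 2 * eps)))).+1.
apply: le_trans (PE L _ _) _ => //; first by rewrite ltnW // ltnS leq_maxl.
rewrite lee_fin ler_pdivrMr ?mulr_gt0 ?exprn_gt0 ?ltr0n //.
rewrite mulrA -ler_pdivrMl ?mulr_gt0 ?exprn_gt0 // mulrC [eps * _]mulrC.
by apply: le_trans (ltW (truncnS_gt _)) _; rewrite ler_nat ltnS leq_maxr.
Qed.

(** The probability of an alternating start and of a monochromatic window is the
    product of the two probabilities, so the union of all failures after an
    alternating start has at most half the probability of that start. *)
Lemma supercritical_all_seen d (T : measurableType d) (R : realType)
    (P : probability T R) (p : R) (M : nat -> R) (X : nat -> {RV P >-> bool}) :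
  0 < p -> p < 1 -> iid_bernoulli p X ->
  ((critical_constant p)%:E < limn_einf (fun n => (M n / ln n%:R)%:E))%E ->
  (forall n, 2 <= M n) ->
  (0 < P [set w | seen_words (edge M) (fun n => X n w) 0%N = setT])%E.
Proof.
move=> p0 p1 Xp /limn_einf_gt_eventually[c Cc [N0 cN0]] M2.
have M0 n : 0 <= M n by exact: le_trans (M2 n).
have [l l0 [CE qE]] := critical_constant_inv p0 p1.
have cl : 1 < c * l by rewrite -ltr_pdivrMr // div1r -CE.
pose len n := (Num.truncn (M n)).-1.
(* Each window fails in two ways, one per letter, so a tail sum of at most 1/4
   leaves half of the probability of an alternating start. *)
have [N tail] := window_tail_small l0 cl M2 cN0 (ltac:(lra) : 0 < (4^-1 : R)).
pose start := [set w | {in iota 0 (N + 2), forall i, X i w = odd i}].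
pose bad n b := [set w | {in iota (n + 2) (len n), forall i, X i w = b}].
have mstart : measurable start := measurable_cylinder X _ odd.
have mbad n b : measurable (bad n b) := measurable_cylinder X _ (fun=> b).
pose A := \prod_(i <- iota 0 (N + 2)) bernoulli_pmf p (odd i).
have A0 : 0 < A by apply: prodr_gt0 => i _; exact: bernoulli_pmf_gt0.
have PA : P start = A%:E := probability_cylinder odd Xp (iota_uniq _ _).
have Pbad n b : (N <= n)%N ->
    (P (start `&` bad n b) <= (A * expR (- l) ^+ len n)%:E)%E.
  move=> Nn; rewrite (probability_cylinderI odd (fun=> b) Xp); last first.
    rewrite cat_uniq !iota_uniq andbT; apply/hasPn => i.
    by rewrite !mem_iota; lia.
  rewrite -/start PA (probability_constant_run b Xp (iota_uniq _ _)) size_iota.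
  rewrite -EFinM lee_fin ler_pM2l //.
  rewrite lerXn2r ?nnegrE ?expR_ge0 ?(ltW (bernoulli_pmf_gt0 _ _ _)) //.
  by rewrite -qE bernoulli_pmf_le_max.
pose badU n := start `&` (bad n true `|` bad n false).
have mbadU n : measurable (badU n).
  by apply: measurableI => //; exact: measurableU.
have PbadU n : (N <= n)%N -> (P (badU n) <= (A * 2 * expR (- l) ^+ len n)%:E)%E.
  move=> Nn; rewrite /badU setIUr.
  apply: le_trans (measureU2 P _ _) _; [exact: measurableI|exact: measurableI|].
  apply: le_trans (leeD (Pbad n true Nn) (Pbad n false Nn)) _.
  by rewrite -EFinD lee_fin le_eqVlt; apply/orP; left; apply/eqP; ring.
pose badA := \bigcup_(n in ~` `I_N) badU n.
have mbadA : measurable badA by apply: bigcup_measurable.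
have PbadA : (P badA < A%:E)%E.
  apply: (@le_lt_trans _ _ (A * 2 * 4^-1)%:E); last by rewrite lte_fin; lra.
  apply: le_trans
    (measure_sigma_subadditive_tail P mbadU mbadA (@subset_refl _ _)) _.
  apply: lime_le; first exact: is_cvg_nneseries.
  apply: nearW => n.
  apply: le_trans (_ : (\sum_(N <= k < n) (A * 2 * expR (- l) ^+ len k)%:E)%E
      <= _)%E.
    by rewrite big_nat [leRHS]big_nat; apply: lee_sum => k /andP[/PbadU].
  by rewrite sumEFin lee_fin -mulr_sumr ler_pM2l ?tail // mulr_gt0.
set E := [set w | _].
have mE : measurable E by exact: measurable_seen_words_setT.
have sub : start `<=` E `|` badA.
  move=> w ws; have [wbad|wbad] := pselect (badA w); [by right|left].
  apply: (all_seen_of_alternating_start M2 ws) => n b Nn run; apply: wbad.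
  exists n; first by apply/negP; rewrite -leqNgt.
  split; first exact: ws.
  by case: b run => run; [left|right].
rewrite ltNge; apply/negP => E0.
have : (P start <= P E + P badA)%E.
  apply: le_trans (measureU2 P mE mbadA).
  by apply: le_measure; rewrite ?inE //; exact: measurableU.
rewrite PA leNgt => /negP; apply.
by apply: le_lt_trans PbadA; rewrite -[leRHS]add0e leeD2r.
Qed.

Theorem theorem1p6 (R : realType) (d : measure_display) (T : measurableType d)
    (P : probability T R) (p : R) (M : nat -> R) (X : nat -> {RV P >-> bool})
    (p_gt0 : 0 < p) (p_lt1 : p < 1)
    (M_ge0 : forall n, 0 <= M n)
    (X_iid : iid_bernoulli p X) :
  ((limn_esup (fun n => (M n / ln n%:R)%:E) < (critical_constant p)%:E)%E ->
     P [set w | seen_words (edge M) (fun n => X n w) 0%N = setT] = 0%E)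
  /\
  (((critical_constant p)%:E < limn_einf (fun n => (M n / ln n%:R)%:E))%E ->
     (forall n, 2 <= M n) ->
     (0 < P [set w | seen_words (edge M) (fun n => X n w) 0%N = setT])%E).
Proof.
split; first exact: subcritical_not_all_seen.
exact: supercritical_all_seen.
Qed.
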